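(* (Weak cocommutativity.) Let $(V,\mathcal{Y},c)$ be a graded vertex coalgebra and let $v'\in(V^{\otimes3})'$. There exists $k\in\mathbb{Z}_+$ such that $$(x_1-x_2)^k\left\langle v',\,(Id_V\otimes\mathcal{Y}(x_2))\mathcal{Y}(x_1)v-(T\otimes Id_V)(Id_V\otimes\mathcal{Y}(x_1))\mathcal{Y}(x_2)v\right\rangle=0$$ for any $v\in V$.
   Context: All vector spaces are over a field $\mathbb{F}$ of characteristic $0$; $x,x_0,x_1,x_2$ are commuting formal variables; $\mathbb{Z}_+$ is the set of positive integers. $\delta(x)=\sum_{n\in\mathbb{Z}}x^n$. For $n\in\mathbb{Z}$, $(x_i\pm x_j)^n$ is expanded in nonnegative integral powers of the second listed variable $x_j$ (this also applies inside $\delta$). $W[[x,x^{-1}]]$ is the space of all doubly infinite formal series with coefficients in $W$, and $W((x^{-1}))$ is the space of those with only finitely many positive powers of $x$. $T(u\otimes v)=v\otimes u$ on $V\otimes V$. Linear maps and pairings act on formal series coefficientwise. A vertex coalgebra $(V,\mathcal{Y},c)$ is a vector space $V$ with linear maps $\mathcal{Y}(x):V\to(V\otimes V)[[x,x^{-1}]]$ and $c:V\to\mathbb{F}$ such that for all $v\in V$: 1. Left counit: $(c\otimes Id_V)\mathcal{Y}(x)v=v$. 2. Cocreation: $(Id_V\otimes c)\mathcal{Y}(x)v\in V[[x]]$ and $\lim_{x\to0}(Id_V\otimes c)\mathcal{Y}(x)v=v$. 3. Truncation: $\mathcal{Y}(x)v\in(V\otimes V)((x^{-1}))$. 4. Jacobi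 identity: $$x_0^{-1}\delta\left(\tfrac{x_1-x_2}{x_0}\right)(Id_V\otimes\mathcal{Y}(x_2))\mathcal{Y}(x_1)-x_0^{-1}\delta\left(\tfrac{x_2-x_1}{-x_0}\right)(T\otimes Id_V)(Id_V\otimes\mathcal{Y}(x_1))\mathcal{Y}(x_2)=x_2^{-1}\delta\left(\tfrac{x_1-x_0}{x_2}\right)(\mathcal{Y}(x_0)\otimes Id_V)\mathcal{Y}(x_2).$$ It is a graded vertex coalgebra if $V=\coprod_{k\in\mathbb{Z}}V_{(k)}$ is $\mathbb{Z}$-graded with $V_{(k)}=0$ for $k$ sufficiently negative and, writing $\mathcal{Y}(x)v=\sum_{k\in\mathbb{Z}}\Delta_k(v)x^{-k-1}$, one has $\Delta_k(v)\in(V\otimes V)_{(r+k+1)}$ for all $v\in V_{(r)}$ and $r,k\in\mathbb{Z}$. For a graded space $W=\coprod_k W_{(k)}$, the graded dual is $W'=\coprod_k \mathrm{Hom}(W_{(k)},\mathbb{F})$, and $\langle\cdot,\cdot\rangle$ is the natural pairing of $W'$ with $W$. $V^{\otimes n}$ is graded by total weight, and $(V^{\otimes n})'$ is its graded dual. *)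

(* Defs.v *)
From HB Require Import structures.
From mathcomp Require Import all_boot all_order all_algebra.
From mathcomp Require Import all_classical.

Set Implicit Arguments.
Unset Strict Implicit.
Unset Printing Implicit Defensive.

Import GRing.Theory.
Local Open Scope classical_set_scope.
Local Open Scope ring_scope.
Local Open Scope quotient_scope.

(* Tensor product of two vector spaces of arbitrary dimension.

   A list [:: (u_1, v_1); ...; (u_n, v_n)] stands for the formal sum of the
   u_i ⊗ v_i; scalars are absorbed in the u_i.  Two formal sums are identified
   when no bilinear map separates them.  That this is the tensor product is
   the content of tpure_bilinear, tensP, tlift_pure and tlift_unique. *)
Section Tensor.
Variables (F : fieldType) (U V : lmodType F).

Definition tsum (W : lmodType F) (f : U -> V -> W) (s : seq (U * V)) : W :=
  \sum_(p <- s) f p.1 p.2.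

Definition tens_equiv (s t : seq (U * V)) : bool :=
  `[< forall (W : lmodType F) (f : {bilinear U -> V -> W}),
        tsum f s = tsum f t >].

Lemma tens_equiv_equiv : equiv_class_of tens_equiv.
Proof.
split=> [s|s t|t s r].
- by apply/asboolP.
- by apply/asboolP/asboolP => H W f; rewrite H.
- by move=> /asboolP H1 /asboolP H2; apply/asboolP => W f; rewrite H1 H2.
Qed.
Canonical tens_equiv_rel := EquivRelPack tens_equiv_equiv.

Definition tens_quot := {eq_quot tens_equiv}.
HB.instance Definition _ := Choice.on tens_quot.
HB.instance Definition _ : EqQuotient _ tens_equiv tens_quot := EqQuotient.on tens_quot.

Definition tlift (W : lmodType F) (f : {bilinear U -> V -> W}) (x : tens_quot) : W :=
  tsum f (repr x).

Lemma tlift_pi (W : lmodType F) (f : {bilinear U -> V -> W}) s :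
  tlift f (\pi_tens_quot s) = tsum f s.
Proof.
rewrite /tlift; have := reprK (\pi_tens_quot s).
by move=> /eqmodP /asboolP; apply.
Qed.

Lemma tens_ext (x y : tens_quot) :
  (forall (W : lmodType F) (f : {bilinear U -> V -> W}), tlift f x = tlift f y) ->
  x = y.
Proof.
move=> H; rewrite -[x]reprK -[y]reprK; apply/eqmodP/asboolP => W f.
exact: H.
Qed.

Let tzero : tens_quot := \pi_tens_quot [::].
Let tadd (x y : tens_quot) : tens_quot := \pi_tens_quot (repr x ++ repr y).
Let tscale (a : F) (x : tens_quot) : tens_quot :=
  \pi_tens_quot [seq (a *: p.1, p.2) | p <- repr x].
Let topp (x : tens_quot) : tens_quot := tscale (-1) x.

Let tlift0 (W : lmodType F) (f : {bilinear U -> V -> W}) : tlift f tzero = 0.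
Proof. by rewrite tlift_pi /tsum big_nil. Qed.
Let tliftD (W : lmodType F) (f : {bilinear U -> V -> W}) x y :
  tlift f (tadd x y) = tlift f x + tlift f y.
Proof. by rewrite tlift_pi /tsum big_cat. Qed.
Let tliftZ (W : lmodType F) (f : {bilinear U -> V -> W}) a x :
  tlift f (tscale a x) = a *: tlift f x.
Proof.
rewrite tlift_pi /tlift /tsum big_map scaler_sumr.
by apply: eq_bigr => p _; rewrite linearZl_LR.
Qed.

Let taddA : associative tadd.
Proof. by move=> x y z; apply: tens_ext => W f; rewrite !tliftD addrA. Qed.
Let taddC : commutative tadd.
Proof. by move=> x y; apply: tens_ext => W f; rewrite !tliftD addrC. Qed.
Let tadd0 : left_id tzero tadd.
Proof. by move=> x; apply: tens_ext => W f; rewrite tliftD tlift0 add0r. Qed.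
Let taddN : left_inverse tzero topp tadd.
Proof.
by move=> x; apply: tens_ext => W f; rewrite tliftD tlift0 tliftZ scaleN1r addNr.
Qed.
HB.instance Definition _ := GRing.isZmodule.Build tens_quot taddA taddC tadd0 taddN.

Let tscaleA a b x : tscale a (tscale b x) = tscale (a * b) x.
Proof. by apply: tens_ext => W f; rewrite !tliftZ scalerA. Qed.
Let tscale1 : left_id 1 tscale.
Proof. by move=> x; apply: tens_ext => W f; rewrite tliftZ scale1r. Qed.
Let tscaleDr : right_distributive tscale +%R.
Proof.
by move=> a x y; apply: tens_ext => W f; rewrite tliftZ !tliftD !tliftZ scalerDr.
Qed.
Let tscaleDl x : {morph tscale^~ x : a b / a + b}.
Proof.
by move=> a b; apply: tens_ext => W f; rewrite tliftZ !tliftD !tliftZ scalerDl.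
Qed.
HB.instance Definition _ :=
  GRing.Zmodule_isLmodule.Build F tens_quot tscaleA tscale1 tscaleDr tscaleDl.

Definition tens : lmodType F := tens_quot.

Lemma tlift_linear (W : lmodType F) (f : {bilinear U -> V -> W}) :
  linear (tlift f).
Proof. by move=> a x y; rewrite tliftD tliftZ. Qed.
HB.instance Definition _ (W : lmodType F) (f : {bilinear U -> V -> W}) :=
  GRing.isLinear.Build F tens W *:%R (tlift f) (tlift_linear f).

Definition tpure (u : U) (v : V) : tens := \pi_tens_quot [:: (u, v)].

Lemma tlift_pure (W : lmodType F) (f : {bilinear U -> V -> W}) u v :
  tlift f (tpure u v) = f u v.
Proof. by rewrite tlift_pi /tsum big_seq1. Qed.

Lemma tpure_bilinear : bilinear_for *:%R *:%R tpure.
Proof.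
split=> [v a u u'|u a v v']; apply: tens_ext => W f.
  by rewrite linearP /= !tlift_pure linearPl.
by rewrite linearP /= !tlift_pure linearPr.
Qed.
HB.instance Definition _ :=
  bilinear_isBilinear.Build F U V tens *:%R *:%R tpure tpure_bilinear.

HB.instance Definition _ (u : U) :=
  GRing.isLinear.Build F V tens *:%R (tpure u) (tpure_bilinear.2 u).

Lemma tensP (x : tens) : exists s : seq (U * V), x = \sum_(p <- s) tpure p.1 p.2.
Proof.
exists (repr x); apply: tens_ext => W f; rewrite linear_sum /= /tlift.
by apply: eq_bigr => p _; rewrite -/(tlift f _) tlift_pure.
Qed.

Lemma tlift_unique (W : lmodType F) (g h : {linear tens -> W}) :
  (forall u v, g (tpure u v) = h (tpure u v)) -> g =1 h.
Proof.
by move=> gh x; have [s ->] := tensP x; rewrite !linear_sum; apply: eq_bigr.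
Qed.

End Tensor.

Notation "U ⊗ V" := (tens U V) (at level 40, left associativity).

Section TensorMaps.
Variable F : fieldType.
Implicit Types U V W : lmodType F.

Definition tmap_pure U U' V V' (f : {linear U -> U'}) (g : {linear V -> V'})
  (u : U) (v : V) : U' ⊗ V' := tpure (f u) (g v).
Lemma tmap_pure_bilinear U U' V V' (f : {linear U -> U'}) (g : {linear V -> V'}) :
  bilinear_for *:%R *:%R (tmap_pure f g).
Proof.
split=> [v a u u'|u a v v'].
  by rewrite /tmap_pure linearP /= linearPl.
by rewrite /tmap_pure linearP /= linearPr.
Qed.
HB.instance Definition _ U U' V V' (f : {linear U -> U'}) (g : {linear V -> V'}) :=
  bilinear_isBilinear.Build F U V (U' ⊗ V') *:%R *:%R (tmap_pure f g)
    (tmap_pure_bilinear f g).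

(* f ⊗ g *)
Definition tmap U U' V V' (f : {linear U -> U'}) (g : {linear V -> V'}) :
  {linear (U ⊗ V) -> (U' ⊗ V')} := tlift (tmap_pure f g).

Definition tswap_pure U V (u : U) (v : V) : V ⊗ U := tpure v u.
Lemma tswap_pure_bilinear U V : bilinear_for *:%R *:%R (@tswap_pure U V).
Proof.
by split=> [v a u u'|u a v v']; rewrite /tswap_pure ?linearPl ?linearPr.
Qed.
HB.instance Definition _ U V :=
  bilinear_isBilinear.Build F U V (V ⊗ U) *:%R *:%R (@tswap_pure U V)
    (@tswap_pure_bilinear U V).

Definition tswap U V : {linear (U ⊗ V) -> (V ⊗ U)} := tlift (@tswap_pure U V).

(* u ⊗ (v ⊗ w) |-> (u ⊗ v) ⊗ w *)
Definition tassoc_pure U V W (u : U) (x : V ⊗ W) : U ⊗ V ⊗ W :=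
  tmap (tpure u) idfun x.
Lemma tassoc_pure_bilinear U V W : bilinear_for *:%R *:%R (@tassoc_pure U V W).
Proof.
split=> [x a u u'|u]; last exact: linearP.
change (tassoc_pure (a *: u + u') x =
        a *: tassoc_pure u x + tassoc_pure u' x).
have [s ->] := tensP x.
have E w : tassoc_pure w (\sum_(p <- s) tpure p.1 p.2) =
           \sum_(p <- s) tpure (tpure w p.1) p.2.
  by rewrite /tassoc_pure linear_sum; apply: eq_bigr => p _; rewrite /= tlift_pure.
rewrite !E scaler_sumr -big_split /=.
by apply: eq_bigr => p _; rewrite linearPl /= linearPl.
Qed.
HB.instance Definition _ U V W :=
  bilinear_isBilinear.Build F U (V ⊗ W) (U ⊗ V ⊗ W) *:%R *:%R (@tassoc_pure U V W)
    (@tassoc_pure_bilinear U V W).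
Definition tassoc U V W : {linear (U ⊗ (V ⊗ W)) -> (U ⊗ V ⊗ W)} :=
  tlift (@tassoc_pure U V W).

Definition scale_pure V (a : F^o) (v : V) : V := a *: v.
Lemma scale_pure_bilinear V : bilinear_for *:%R *:%R (@scale_pure V).
Proof.
split=> [v a u u'|u a v v'].
  by rewrite /scale_pure scalerDl; congr (_ + _); rewrite [RHS]scalerA.
rewrite /scale_pure scalerDr; congr (_ + _).
by rewrite [RHS]scalerA scalerA mulrC.
Qed.
HB.instance Definition _ V :=
  bilinear_isBilinear.Build F F^o V V *:%R *:%R (@scale_pure V)
    (@scale_pure_bilinear V).

(* the canonical identifications F ⊗ V = V and V ⊗ F = V *)
Definition tunitl V : {linear (F^o ⊗ V) -> V} := tlift (@scale_pure V).
Definition tunitr V : {linear (V ⊗ F^o) -> V} := tunitl V \o tswap V F^o.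

Lemma tmapE U U' V V' (f : {linear U -> U'}) (g : {linear V -> V'}) u v :
  tmap f g (tpure u v) = tpure (f u) (g v).
Proof. by rewrite /= tlift_pure. Qed.
Lemma tswapE U V (u : U) (v : V) : tswap U V (tpure u v) = tpure v u.
Proof. by rewrite /= tlift_pure. Qed.
Lemma tassocE U V W (u : U) (v : V) (w : W) :
  tassoc U V W (tpure u (tpure v w)) = tpure (tpure u v) w.
Proof. by rewrite /= tlift_pure tmapE. Qed.
Lemma tunitlE V a (v : V) : tunitl V (tpure (a : F^o) v) = a *: v.
Proof. by rewrite /= tlift_pure. Qed.
Lemma tunitrE V a (v : V) : tunitr V (tpure v (a : F^o)) = a *: v.
Proof. by rewrite /= tlift_pure tunitlE. Qed.

End TensorMaps.

(* Formal series.  A doubly infinite series in x with coefficients in W is the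
   function int -> W giving the coefficient of x^n; a series in x_1, x_2 (resp.
   x_0, x_1, x_2) is a function on exponents (e1, e2) : int * int (resp.
   (e0, e1, e2) : int * int * int). *)
Section FormalSeries.
Variable F : fieldType.

(* Product of a scalar series and a vector series.  The sum is over all
   exponents; \sum_(d \in _) is the sum of a finitely supported family, and
   is 0 by convention if the support is infinite.  In the Jacobi identity the
   support is finite because of the truncation condition. *)
Definition ser_mul (I : zmodType) (W : lmodType F) (a : I -> F) (w : I -> W) :
  I -> W := fun e => \sum_(d \in [set: I]) a d *: w (e - d).

(* n (n - 1) ... (n - k + 1) / k!, for any integer n *)
Definition gbinom (n : int) (k : nat) : F :=
  (\prod_(i < k) (n%:~R - i%:R)) / k`!%:R.

(* coefficient of x^i y^j in (x - y)^n, expanded in nonnegative powers of y *)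
Definition sub_pow (n i j : int) : F :=
  if j is Posz k then
    if i == n - k%:Z then (-1) ^+ k * gbinom n k else 0
  else 0.

(* coefficient of z^p x^i y^j in z^-1 δ((x - y) / (s z)), that is in the sum
   over n of s^(-n) z^(-n-1) (x - y)^n; only n = -p-1 contributes *)
Definition inv_delta (s : F) (p i j : int) : F :=
  s ^ (p + 1) * sub_pow (- p - 1) i j.

End FormalSeries.

Section VertexCoalgebra.
Variables (F : fieldType) (V : lmodType F).
Variables (Y : {linear V -> (int -> V ⊗ V)}) (c : {linear V -> F^o}).

(* coefficient of x^n in Y(x) *)
Definition cprod (n : int) (v : V) : V ⊗ V := Y v n.
Lemma cprod_linear n : linear (cprod n).
Proof. by move=> a u v; rewrite /cprod linearP. Qed.
HB.instance Definition _ n :=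
  GRing.isLinear.Build F V (V ⊗ V) *:%R (cprod n) (cprod_linear n).

(* coefficient of x_1^e1 x_2^e2 in (Id ⊗ Y(x_2)) Y(x_1) v *)
Definition IdY_Y (v : V) (e1 e2 : int) : V ⊗ V ⊗ V :=
  tassoc V V V (tmap idfun (cprod e2) (cprod e1 v)).

(* coefficient of x_1^e1 x_2^e2 in (T ⊗ Id) (Id ⊗ Y(x_1)) Y(x_2) v *)
Definition TId_IdY_Y (v : V) (e1 e2 : int) : V ⊗ V ⊗ V :=
  tmap (tswap V V) idfun
    (tassoc V V V (tmap idfun (cprod e1) (cprod e2 v))).

(* coefficient of x_0^e0 x_2^e2 in (Y(x_0) ⊗ Id) Y(x_2) v *)
Definition YId_Y (v : V) (e0 e2 : int) : V ⊗ V ⊗ V :=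
  tmap (cprod e0) idfun (cprod e2 v).

(* A series not involving one of the variables is viewed as a series in
   x_0, x_1, x_2 supported at exponent 0 of that variable.  Since the variables
   of inv_delta are listed as in z^-1 δ((x - y) / (s z)), the delta functions
   are x_0^-1 δ((x_1 - x_2) / x_0), x_0^-1 δ((x_2 - x_1) / (- x_0)) and
   x_2^-1 δ((x_1 - x_0) / x_2). *)
Definition jacobi1 (v : V) : int * int * int -> V ⊗ V ⊗ V :=
  ser_mul (fun '(e0, e1, e2) => inv_delta 1 e0 e1 e2)
          (fun '(e0, e1, e2) => if e0 == 0 then IdY_Y v e1 e2 else 0).
Definition jacobi2 (v : V) : int * int * int -> V ⊗ V ⊗ V :=
  ser_mul (fun '(e0, e1, e2) => inv_delta (-1) e0 e2 e1)
          (fun '(e0, e1, e2) => if e0 == 0 then TId_IdY_Y v e1 e2 else 0).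
Definition jacobi3 (v : V) : int * int * int -> V ⊗ V ⊗ V :=
  ser_mul (fun '(e0, e1, e2) => inv_delta 1 e2 e1 e0)
          (fun '(e0, e1, e2) => if e1 == 0 then YId_Y v e0 e2 else 0).

Record vertex_coalgebra : Prop := {
  left_counit : forall v n,
    tunitl V (tmap c idfun (Y v n)) = if n == 0 then v else 0;
  cocreation_series : forall v n, (n < 0)%R -> tunitr V (tmap idfun c (Y v n)) = 0;
  cocreation_limit : forall v, tunitr V (tmap idfun c (Y v 0)) = v;
  truncation : forall v, exists N : int, forall n, (N < n)%R -> Y v n = 0;
  jacobi_identity : forall v e, jacobi1 v e - jacobi2 v e = jacobi3 v e
}.

End VertexCoalgebra.

Section Gradings.
Variable F : fieldType.

(* W is the internal direct sum of the subspaces gr k *)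
Record is_grading (W : lmodType F) (gr : int -> set W) : Prop := {
  grading_subspace : forall k,
    gr k 0 /\ forall a u w, gr k u -> gr k w -> gr k (a *: u + w);
  grading_direct_sum : forall w, exists! f : int -> W,
    [/\ forall k, gr k (f k), finite_set [set k | f k != 0]
      & w = \sum_(k \in [set: int]) f k]
}.

Definition linspan (W : lmodType F) (P : set W) : set W :=
  [set w | exists (n : nat) (a : 'I_n -> F) (t : 'I_n -> W),
             (forall i, P (t i)) /\ w = \sum_(i < n) a i *: t i].

(* total weight grading on U ⊗ V *)
Definition tens_gr (U V : lmodType F) (gU : int -> set U) (gV : int -> set V)
    (m : int) : set (U ⊗ V) :=
  linspan [set t | exists i j u v, [/\ i + j = m, gU i u, gV j v & t = tpure u v]].

(* The graded dual, the direct sum of the duals of the gr k, is realized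
   inside the full dual: a linear functional on W is the family of its
   restrictions to the gr k, and lies in the direct sum when all but finitely
   many of these vanish.  The pairing with W is then evaluation. *)
Definition graded_dual (W : lmodType F) (gr : int -> set W) :
    set {linear W -> F^o} :=
  [set phi | finite_set [set k | exists2 w, gr k w & phi w != 0]].

(* Δ_k(v), the coefficient of x^(-k-1), is Y v (- k - 1). *)
Record graded_vertex_coalgebra (V : lmodType F)
    (Y : {linear V -> (int -> V ⊗ V)}) (c : {linear V -> F^o})
    (gr : int -> set V) : Prop := {
  graded_vertex_coalgebraW : vertex_coalgebra Y c;
  graded_is_grading : is_grading gr;
  graded_bounded_below : exists N : int, forall k, (k < N)%R -> gr k = [set 0];
  graded_weight : forall r k v, gr r v -> tens_gr gr gr (r + k + 1) (Y v (- k - 1))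
}.

End Gradings.

(* Main.v *)
Require Import Defs.
From HB Require Import structures.
From mathcomp Require Import all_boot all_order all_algebra.
From mathcomp Require Import all_classical.
From mathcomp Require Import zify.

Set Implicit Arguments.
Unset Strict Implicit.
Unset Printing Implicit Defensive.

Import Order.TTheory GRing.Theory.
Local Open Scope classical_set_scope.
Local Open Scope ring_scope.

(** The coefficient of [x_0^(-k-1)] in [x_0^-1 δ((x_1 - x_2) / x_0)] is
    [(x_1 - x_2)^k], and for [k >= 0] the two expansions of this power agree,
    so the same coefficient of [x_0^-1 δ((x_2 - x_1) / (- x_0))] is again
    [(x_1 - x_2)^k].  Hence the coefficient of [x_0^(-k-1)] on the left of the
    Jacobi identity is [(x_1 - x_2)^k] times the difference of the two iterated
    coproducts ([sub_pow_jacobi]).  It remains to see that [v'] annihilates the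
    corresponding coefficient on the right, for one [k] that suits every [v].

    This is a weight count.  On the right, [x_2^-1 δ((x_1 - x_0) / x_2)] only
    contributes nonnegative powers of [x_0], so only the coefficients of
    [x_0^e0 x_2^e2] in [(Y(x_0) ⊗ Id) Y(x_2) v] with [e0 <= -k-1] matter
    ([jacobi3_vanish]).  Let the weights of [V] be at least [N] and let [v']
    vanish in weights above [M].  For [v] of weight [r], the coefficient of
    [x_2^e2] in [Y(x_2) v] has weight [r - e2], so it is zero unless
    [r - e2 >= 2 N]; in that case the coefficient of [x_0^e0] has weight
    [r - e2 - e0 >= 2 N - e0], which exceeds [M] as soon as [e0 < 2 N - M]
    ([YId_Y_vanish]).  The bound does not involve [v], so by linearity it holds
    for all vectors, homogeneous or not. *)

Section BinomialPowers.
Variable F : fieldType.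
Hypothesis charF0 : [pchar F] =i pred0.

(** Characteristic 0 enters here: the division by [k`!] in [gbinom] is a genuine
    division. *)
Lemma gbinom_nat (n k : nat) : gbinom F n%:Z k = 'C(n, k)%:R.
Proof.
have prodE : \prod_(i < k) (n%:Z%:~R - i%:R) = (n ^_ k)%:R :> F.
  elim: k => [|k IHk]; first by rewrite big_ord0 ffactn0.
  rewrite big_ord_recr /= IHk ffactnSr natrM.
  have [le_kn|lt_nk] := leqP k n; first by rewrite natrB.
  by rewrite ffact_small // !mul0r.
rewrite /gbinom prodE -bin_ffact natrM mulfK //.
by rewrite ((pcharf0P F).1 charF0) -lt0n fact_gt0.
Qed.

Lemma sub_pow_nat (k l : nat) :
  sub_pow F k%:Z (k%:Z - l%:Z) l%:Z = (-1) ^+ l * 'C(k, l)%:R.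
Proof. by rewrite /= eqxx gbinom_nat. Qed.

Lemma sub_pow_support (k : nat) (i j : int) : sub_pow F k%:Z i j != 0 ->
  exists l : 'I_k.+1, i = k%:Z - (l : nat)%:Z /\ j = (l : nat)%:Z.
Proof.
case: j => [l|l] /=; last by rewrite eqxx.
case: (eqVneq i (k%:Z - l%:Z)) => [->|_]; last by rewrite eqxx.
rewrite gbinom_nat; have [le_lk _|lt_kl] := leqP l k; last first.
  by rewrite bin_small // mulr0 eqxx.
by exists (Ordinal (le_lk : (l < k.+1)%N)).
Qed.

End BinomialPowers.

Section SeriesProducts.
Variables (F : fieldType).

(** Turns a product of series into an ordinary finite sum once the indices of the
    possibly nonzero terms are enumerated without repetition. *)
Lemma ser_mul_seq (I : zmodType) (W : lmodType F) (a : I -> F) (w : I -> W)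
    (e : I) (n : nat) (s : 'I_n -> I) :
  injective s ->
  (forall d, a d *: w (e - d) != 0 -> exists i, d = s i) ->
  ser_mul a w e = \sum_(i < n) a (s i) *: w (e - s i).
Proof.
move=> s_inj supp; rewrite /ser_mul (fsbigE (map s (enum 'I_n))) //=.
- by rewrite big_map big_enum_cond; apply: eq_bigl => i; rewrite in_setT.
- by rewrite map_inj_uniq ?enum_uniq.
move=> d _; apply: contraNeq => /supp[i ->].
by rewrite map_f ?mem_enum.
Qed.

(** A sum over an infinite support is 0 by convention, so a property closed under
    finite sums can be checked on the terms without discussing the support. *)
Lemma linear_ser_mul_eq0 (I : zmodType) (W W' : lmodType F)
    (f : {linear W -> W'}) (a : I -> F) (w : I -> W) (e : I) :
  (forall d, a d *: f (w (e - d)) = 0) -> f (ser_mul a w e) = 0.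
Proof.
move=> fw0; rewrite /ser_mul; elim/big_ind: _ => [|x y fx fy|d _].
- exact: raddf0.
- by rewrite linearD fx fy addr0.
- by rewrite linearZ_LR fw0.
Qed.

End SeriesProducts.

Section JacobiCoefficients.
Variables (F : fieldType) (V : lmodType F) (Y : {linear V -> (int -> V ⊗ V)}).
Hypothesis charF0 : [pchar F] =i pred0.

(** The only power of [(x - y) / (s z)] that contributes to [z^(-k-1)] in the
    delta function is the [k]-th. *)
Lemma inv_delta_neg (s : F) (k : nat) (i j : int) :
  inv_delta s (- k%:Z - 1) i j = s ^- k * sub_pow F k%:Z i j.
Proof.
rewrite /inv_delta.
have -> : - (- k%:Z - 1) - 1 = k%:Z by lia.
by rewrite subrK exprnN.
Qed.

Lemma sub_pow_ser_mul (W : lmodType F) (w : int * int -> W) (k : nat)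
    (e1 e2 : int) :
  ser_mul (fun '(i, j) => sub_pow F k%:Z i j) w (e1, e2) =
  \sum_(l < k.+1) ((-1) ^+ l * 'C(k, l)%:R) *:
                  w (e1 - (k%:Z - (l : nat)%:Z), e2 - (l : nat)%:Z).
Proof.
rewrite (@ser_mul_seq _ _ _ _ _ _ k.+1
  (fun l => (k%:Z - (l : nat)%:Z, (l : nat)%:Z))).
- by apply: eq_bigr => l _; rewrite sub_pow_nat.
- by move=> l l' [_ /val_inj].
move=> [i j]; rewrite scaler_eq0 negb_or => /andP[/(sub_pow_support charF0)].
by move=> [l [-> ->]] _; exists l.
Qed.

Lemma jacobi1_neg (v : V) (k : nat) (e1 e2 : int) :
  jacobi1 Y v (- k%:Z - 1, e1, e2) =
  \sum_(l < k.+1) ((-1) ^+ l * 'C(k, l)%:R) *: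
     IdY_Y Y v (e1 - (k%:Z - (l : nat)%:Z)) (e2 - (l : nat)%:Z).
Proof.
rewrite /jacobi1 (@ser_mul_seq _ _ _ _ _ _ k.+1
  (fun l => (- k%:Z - 1, k%:Z - (l : nat)%:Z, (l : nat)%:Z))).
- apply: eq_bigr => l _.
  by rewrite inv_delta_neg sub_pow_nat //= subrr eqxx expr1n invr1 mul1r.
- by move=> l l' [_ /val_inj].
move=> [[d0 d1] d2] /=.
case: (eqVneq (- k%:Z - 1 - d0) 0) => [/subr0_eq <-|_]; last by rewrite scaler0 eqxx.
rewrite inv_delta_neg scaler_eq0 negb_or mulf_eq0 negb_or.
move=> /andP[/andP[_ /(sub_pow_support charF0)]].
by move=> [l [-> ->]] _; exists l.
Qed.

(** Here [(x_2 - x_1)^k] is expanded in powers of [x_1] and carries the sign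
    [(-1)^k] of the delta function.  Reversing the binomial expansion turns it
    into the expansion of [(x_1 - x_2)^k], so that the coefficients coincide with
    those of [jacobi1_neg]. *)
Lemma jacobi2_neg (v : V) (k : nat) (e1 e2 : int) :
  jacobi2 Y v (- k%:Z - 1, e1, e2) =
  \sum_(l < k.+1) ((-1) ^+ l * 'C(k, l)%:R) *:
     TId_IdY_Y Y v (e1 - (k%:Z - (l : nat)%:Z)) (e2 - (l : nat)%:Z).
Proof.
rewrite /jacobi2 (@ser_mul_seq _ _ _ _ _ _ k.+1
  (fun l => (- k%:Z - 1, (l : nat)%:Z, k%:Z - (l : nat)%:Z))).
- rewrite [RHS](reindex_inj rev_ord_inj); apply: eq_bigr => l _.
  have le_lk : (l <= k)%N by rewrite -ltnS.
  rewrite inv_delta_neg sub_pow_nat //= subrr eqxx subSS bin_sub //.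
  rewrite mulrA; congr ((_ * _) *: TId_IdY_Y _ _ _ _); try lia.
  rewrite -exprVn invrN1 -exprD -[LHS]signr_odd -[RHS]signr_odd.
  by rewrite oddD oddB // addKb.
- by move=> l l' [/val_inj].
move=> [[d0 d1] d2] /=.
case: (eqVneq (- k%:Z - 1 - d0) 0) => [/subr0_eq <-|_]; last by rewrite scaler0 eqxx.
rewrite inv_delta_neg scaler_eq0 negb_or mulf_eq0 negb_or.
move=> /andP[/andP[_ /(sub_pow_support charF0)]].
by move=> [l [-> ->]] _; exists l.
Qed.

Lemma sub_pow_jacobi (W : lmodType F) (f : {linear (V ⊗ V ⊗ V) -> W}) (v : V)
    (k : nat) (e1 e2 : int) :
  ser_mul (fun '(i, j) => sub_pow F k%:Z i j)
          (fun '(i, j) => f (IdY_Y Y v i j - TId_IdY_Y Y v i j)) (e1, e2) =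
  f (jacobi1 Y v (- k%:Z - 1, e1, e2) - jacobi2 Y v (- k%:Z - 1, e1, e2)).
Proof.
rewrite sub_pow_ser_mul jacobi1_neg jacobi2_neg -sumrB linear_sum.
by apply: eq_bigr => l _; rewrite -scalerBr linearZ.
Qed.

End JacobiCoefficients.

Section Weights.
Variable F : fieldType.

Lemma linspan_gen (W : lmodType F) (P : set W) (t : W) : P t -> linspan P t.
Proof.
move=> Pt; exists 1, (fun=> 1), (fun=> t); split=> //.
by rewrite big_ord1 scale1r.
Qed.

Lemma linear_linspan_eq0 (W W' : lmodType F) (f : {linear W -> W'}) (P : set W)
    (w : W) :
  (forall t, P t -> f t = 0) -> linspan P w -> f w = 0.
Proof.
move=> fP0 [n [a [t [Pt ->]]]]; rewrite linear_sum big1 // => i _.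
by rewrite linearZ_LR fP0 // scaler0.
Qed.

Lemma linear_grading_eq0 (W W' : lmodType F) (gr : int -> set W)
    (f : {linear W -> W'}) :
  is_grading gr -> (forall k w, gr k w -> f w = 0) -> forall w, f w = 0.
Proof.
move=> [_ dsum] fgr0 w; have [g [[gr_g _ ->] _]] := dsum w.
elim/big_ind: _ => [|x y fx fy|k _]; first exact: raddf0.
- by rewrite linearD fx fy addr0.
- exact: fgr0 (gr_g k).
Qed.

Lemma tens_gr_pure (U V : lmodType F) (gU : int -> set U) (gV : int -> set V)
    (i j : int) (u : U) (v : V) :
  gU i u -> gV j v -> tens_gr gU gV (i + j) (tpure u v).
Proof. by move=> gu gv; apply: linspan_gen; exists i, j, u, v. Qed.

(** In a pure tensor of total weight below [M + N], one of the two factors lies in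
    a zero weight space. *)
Lemma tens_gr_below (U V : lmodType F) (gU : int -> set U) (gV : int -> set V)
    (M N m : int) (t : U ⊗ V) :
  (forall k, (k < M)%R -> gU k = [set 0]) ->
  (forall k, (k < N)%R -> gV k = [set 0]) ->
  (m < M + N)%R -> tens_gr gU gV m t -> t = 0.
Proof.
move=> belowU belowV lt_m.
apply: (@linear_linspan_eq0 _ _ idfun) => _ [i [j [u [v [ij gu gv ->]]]]] /=.
have [lt_iM|le_Mi] := ltP i M.
  by move: gu; rewrite belowU // => /= ->; rewrite linear0l.
have lt_jN : (j < N)%R by lia.
by move: gv; rewrite belowV // => /= ->; rewrite raddf0.
Qed.

Lemma graded_dual_bounded (W : lmodType F) (gr : int -> set W)
    (phi : {linear W -> F^o}) :
  graded_dual gr phi ->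
  exists M : int, forall k w, (M < k)%R -> gr k w -> phi w = 0.
Proof.
move=> /finite_seqP[s sE]; exists (\big[Order.max/0]_(k <- s) k) => k w lt_k grw.
apply/eqP/negP => /negP phiw; have : [set` s] k by rewrite -sE; exists w.
move=> /= ks; have := @bigmax_sup_seq _ _ _ s 0 k xpredT k id ks isT (lexx k).
by rewrite leNgt lt_k.
Qed.

End Weights.

Section Vanishing.
Variables (F : fieldType) (V : lmodType F) (Y : {linear V -> (int -> V ⊗ V)}).
Variables (c : {linear V -> F^o}) (gr : int -> set V).
Hypothesis HV : graded_vertex_coalgebra Y c gr.

Lemma cprod_weight (r n : int) (v : V) :
  gr r v -> tens_gr gr gr (r - n) (cprod Y n v).
Proof.
move=> grv; have := graded_weight HV (- n - 1) grv.
by rewrite /cprod; congr (tens_gr _ _ _ (Y v _)); lia.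
Qed.

(** Applying the coefficient of [x^n] in [Y(x)] to the left factor lowers the
    total weight by [n]. *)
Lemma YId_weight (W : lmodType F) (f : {linear (V ⊗ V ⊗ V) -> W}) (M m n : int)
    (t : V ⊗ V) :
  (forall k w, (M < k)%R -> tens_gr (tens_gr gr gr) gr k w -> f w = 0) ->
  (M < m - n)%R -> tens_gr gr gr m t -> f (tmap (cprod Y n) idfun t) = 0.
Proof.
move=> f0 lt_M; apply: (@linear_linspan_eq0 _ _ _ (f \o tmap (cprod Y n) idfun)).
move=> _ [i [j [u [v [ij gu gv ->]]]]] /=.
rewrite [tlift _ _]tmapE; apply: (f0 (i - n + j)); first by lia.
by apply: tens_gr_pure => //; apply: cprod_weight.
Qed.

(** The weight count, with a bound uniform in [v]: for very negative [e0], either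
    the weight before the second coproduct is too small for [V ⊗ V], or the
    weight after it is too large for [f]. *)
Lemma YId_Y_vanish (W : lmodType F) (f : {linear (V ⊗ V ⊗ V) -> W}) (M : int) :
  (forall k w, (M < k)%R -> tens_gr (tens_gr gr gr) gr k w -> f w = 0) ->
  exists N : int, forall v e0 e2, (e0 < N)%R -> f (YId_Y Y v e0 e2) = 0.
Proof.
move=> f0; have [N below] := graded_bounded_below HV.
exists (N + N - M) => v e0 e2 lt_e0.
apply: (@linear_grading_eq0 _ _ _ _
  (f \o tmap (cprod Y e0) idfun \o cprod Y e2) (graded_is_grading HV)).
move=> r u gru /=; have wt := cprod_weight e2 gru.
have [lt_r|le_r] := ltP (r - e2) (N + N).
  by rewrite (tens_gr_below below below lt_r wt) !raddf0.
by apply: (YId_weight f0 _ wt); lia.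
Qed.

(** [(x_1 - x_0)^n] contains only nonnegative powers of [x_0], so the coefficient
    of [x_0^e0] involves only exponents [n1 <= e0] of the other factor. *)
Lemma jacobi3_vanish (W : lmodType F) (f : {linear (V ⊗ V ⊗ V) -> W}) (N : int)
    (v : V) (e0 e1 e2 : int) :
  (forall n1 n2, (n1 < N)%R -> f (YId_Y Y v n1 n2) = 0) ->
  (e0 < N)%R -> f (jacobi3 Y v (e0, e1, e2)) = 0.
Proof.
move=> f0 lt_e0; apply: linear_ser_mul_eq0 => -[[d0 d1] d2] /=.
case: eqP => _; last by rewrite raddf0 scaler0.
case: d0 => [d0|d0]; last by rewrite /inv_delta mulr0 scale0r.
by rewrite f0 ?scaler0 //; lia.
Qed.

End Vanishing.

Theorem proposition2p6 (F : fieldType) (charF0 : [pchar F] =i pred0)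
    (V : lmodType F) (Y : {linear V -> (int -> V ⊗ V)}) (c : {linear V -> F^o})
    (gr : int -> set V) (HV : graded_vertex_coalgebra Y c gr)
    (v' : {linear (V ⊗ V ⊗ V) -> F^o})
    (Hv' : graded_dual (tens_gr (tens_gr gr gr) gr) v') :
  exists k : nat, (0 < k)%N /\
    forall v : V,
      ser_mul (fun '(e1, e2) => sub_pow F k%:Z e1 e2)
              (fun '(e1, e2) => v' (IdY_Y Y v e1 e2 - TId_IdY_Y Y v e1 e2))
      = (fun=> 0).
Proof.
have [M vanishM] := graded_dual_bounded Hv'.
have [N vanishN] := YId_Y_vanish HV vanishM.
(* [k = |N| + 1] makes the exponent [- k - 1] smaller than [N]. *)
exists `|N|.+1; split=> // v; apply/funext => -[e1 e2].
rewrite (sub_pow_jacobi Y charF0 v').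
rewrite (jacobi_identity (graded_vertex_coalgebraW HV)).
by apply: (jacobi3_vanish (N := N)) => [n1 n2|]; [exact: vanishN|lia].
Qed.
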